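(* Suppose $t_1,t_2,\ldots,t_d\in\mathbb{Z}_{\ge 2}$ are pairwise coprime (with $d \geq 1$), let $L=t_1t_2\cdots t_d$, and let $S=\langle L/t_1,\ldots,L/t_d\rangle$. If $m\in S$ and $L\nmid m$, then $\chi(\Delta_m)=0$.
   Context: For positive integers $n_1,\dots,n_d$, $\langle n_1,\ldots,n_d\rangle=\{\alpha_1n_1+\cdots+\alpha_dn_d:\alpha_i\in\mathbb{Z}_{\ge 0}\}$. Write $[d]=\{1,\ldots,d\}$, and for $F\subseteq[d]$ write $n_F=\sum_{i\in F}n_i$; here $n_i=L/t_i$. For a numerical semigroup $S=\langle n_1,\ldots,n_d\rangle$ with minimal generators $n_1,\ldots,n_d$ and $m\in S$, the squarefree divisor complex of $m$ is the simplicial complex $\Delta_m=\{F\subseteq[d]:m-n_F\in S\}$. The Euler characteristic of a simplicial complex $\Delta$ is $\chi(\Delta)=\sum_{F\in\Delta}(-1)^{|F|}$, where the sum includes the empty face. *)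

(* Defs.v *)
From mathcomp Require Import all_boot all_order all_algebra.
From mathcomp Require Import boolp classical_sets.

Set Implicit Arguments.
Unset Strict Implicit.
Unset Printing Implicit Defensive.

Import GRing.Theory.

Local Open Scope nat_scope.

Definition semigroup_gen (d : nat) (n : 'I_d -> nat) : set nat :=
  [set s | exists a : 'I_d -> nat, s = \sum_(i < d) a i * n i]%classic.

(* The guard [\sum_(i in F) n i <= m] is needed because subtraction on nat is
   truncated: [m - n_F] must be computed in the integers, and a negative
   integer is never in the semigroup. *)
Definition sqfree_divisor_complex (d : nat) (n : 'I_d -> nat) (m : nat) :
    {set {set 'I_d}} :=
  [set F : {set 'I_d} | (\sum_(i in F) n i <= m)
                        && (m - \sum_(i in F) n i \in semigroup_gen n)].

(* The empty face is counted, with sign +1. *)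
Definition euler_char (T : finType) (D : {set {set T}}) : int :=
  (\sum_(F in D) (-1) ^+ #|F|)%R.

Lemma sqfree_divisor_complex_sub (d : nat) (n : 'I_d -> nat) (m : nat)
    (F G : {set 'I_d}) :
  G \subset F -> F \in sqfree_divisor_complex n m ->
  G \in sqfree_divisor_complex n m.
Proof.
move=> sGF; rewrite !inE => /andP[leFm /set_mem[a Ea]].
have EF : \sum_(i in F) n i = \sum_(i in G) n i + \sum_(i in F :\: G) n i.
  by rewrite (big_setID G) /= (finset.setIidPr sGF).
have leGm : \sum_(i in G) n i <= m.
  by apply: leq_trans leFm; rewrite EF leq_addr.
apply/andP; split=> //; apply/mem_set.
exists (fun i => a i + (i \in F :\: G)).
have -> : m - \sum_(i in G) n i
        = (m - \sum_(i in F) n i) + \sum_(i in F :\: G) n i.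
  apply: (@addIn (\sum_(i in G) n i)).
  by rewrite subnK // -addnA [X in _ + X]addnC -EF subnK.
rewrite Ea [X in _ + X]big_mkcond -big_split /=.
by apply: eq_bigr => i _; rewrite mulnDl; case: (i \in _); rewrite ?mul1n ?mul0n.
Qed.

(* Main.v *)
Require Import Defs.
From mathcomp Require Import all_boot all_order all_algebra.
From mathcomp Require Import boolp classical_sets.

Import GRing.Theory.

(** Since the [t i] are pairwise coprime and [L] does not divide [m], some
    [t j] does not divide [m].  The complex is then a cone with apex [j], which
    forces its Euler characteristic to vanish.

    To see that it is a cone, let [F] be a face that avoids [j], and write
    [m - n_F] as the sum of the [a i * n i].  Modulo [t j] every [n i] with
    [i != j] vanishes, so [m] is congruent to [a j * n j]; as [t j] does not
    divide [m], the coefficient [a j] is positive, and lowering it by one shows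
    that [j |: F] is a face ([sqfree_divisor_complex_apex]).  In a cone, adding
    or removing the apex pairs the faces off with opposite signs
    ([euler_char_cone]). *)

(** The faces containing [j] are the [j |: F] for the faces [F] avoiding [j],
    and each cancels against its [F]. *)
Lemma euler_char_cone (T : finType) (D : {set {set T}}) (j : T) :
  (forall F : {set T}, j \notin F -> (j |: F \in D) = (F \in D)) ->
  euler_char D = 0%R.
Proof.
move=> coneD; rewrite /euler_char (bigID (fun F : {set T} => j \in F)) /=.
rewrite (reindex_onto (fun F => j |: F) (fun F => F :\ j)) /=; last first.
  by move=> F /andP[_ jF]; rewrite finset.setD1K.
rewrite (eq_bigl (fun F : {set T} => (F \in D) && (j \notin F))); last first.
  move=> F; rewrite setU11 andbT; have [jF | njF] := boolP (j \in F).
    rewrite andbF; apply/negbTE/negP => /andP[_ /eqP eF].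
    by move: jF; rewrite -eF setD11.
  by rewrite setU1K // eqxx coneD.
rewrite -big_split /= big1 // => F /andP[_ njF].
by rewrite cardsU1 njF exprS mulN1r addNr.
Qed.

Lemma dvdn_prod_coprime (I : eqType) (r : seq I) (t : I -> nat) (m : nat) :
  uniq r -> (forall i j, i != j -> coprime (t i) (t j)) ->
  (forall i, i \in r -> t i %| m) -> \prod_(i <- r) t i %| m.
Proof.
move=> + cop; elim: r => [|x r IHr] /=; first by rewrite big_nil dvd1n.
move=> /andP[xr ur] dvd_m; rewrite big_cons Gauss_dvd.
  rewrite dvd_m ?mem_head // IHr // => i ir.
  by apply: dvd_m; rewrite inE ir orbT.
rewrite big_seq; elim/big_ind: _ => [|a b ca cb|i ir].
- exact: coprimen1.
- by rewrite coprimeMr ca.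
by apply: cop; apply: contraNneq xr => ->.
Qed.

(** If [k] divides every generator except [n j], then any element of the
    semigroup not divisible by [k] must use [n j], so [n j] can be subtracted
    from it. *)
Lemma semigroup_gen_sub (d : nat) (n : 'I_d -> nat) (j : 'I_d) (k s : nat) :
  (forall i, i != j -> k %| n i) -> ~~ (k %| s) -> s \in semigroup_gen n ->
  (n j <= s) && (s - n j \in semigroup_gen n).
Proof.
move=> dvd_n nks /set_mem[a Es].
have dvd_rest : k %| \sum_(i < d | i != j) a i * n i.
  by apply: dvdn_sum => i ij; rewrite dvdn_mull // dvd_n.
have aj_gt0 : 0 < a j.
  rewrite lt0n; apply: contraNneq nks => aj0.
  by rewrite Es (bigD1 j) //= aj0 mul0n.
have Es' : s = \sum_(i < d) (a i - (i == j)) * n i + n j.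
  rewrite Es (bigD1 j) //= [in RHS](bigD1 j) //= eqxx addnAC.
  rewrite -mulSnr subn1 prednK //; congr (_ + _).
  by apply: eq_bigr => i /negbTE ->; rewrite subn0.
rewrite Es' leq_addl addnK; apply/mem_set.
by exists (fun i => a i - (i == j)).
Qed.

(** The degree [m - n_F] of a face [F] avoiding [j] is congruent to [m] modulo
    [k], so [semigroup_gen_sub] applies to it. *)
Lemma sqfree_divisor_complex_apex (d : nat) (n : 'I_d -> nat) (j : 'I_d)
    (k m : nat) (F : {set 'I_d}) :
  (forall i, i != j -> k %| n i) -> ~~ (k %| m) -> j \notin F ->
  (j |: F \in sqfree_divisor_complex n m) = (F \in sqfree_divisor_complex n m).
Proof.
move=> dvd_n nkm njF; apply/idP/idP.
  by apply: sqfree_divisor_complex_sub; apply: finset.subsetUr.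
rewrite !inE => /andP[leFm SF].
have dvd_nF : k %| \sum_(i in F) n i.
  by apply: dvdn_sum => i iF; apply: dvd_n; apply: contraNneq njF => <-.
have nk_sub : ~~ (k %| m - \sum_(i in F) n i).
  by apply: contra nkm => dvd_sub; rewrite -(subnK leFm) dvdn_add.
have /andP[le_nj Sj] := semigroup_gen_sub _ _ _ _ _ dvd_n nk_sub SF.
rewrite big_setU1 //= addnC subnDA Sj andbT.
by rewrite -leq_subRL.
Qed.

Theorem theorem3p2 (d : nat) (t : 'I_d -> nat) (m : nat) :
  0 < d ->
  (forall i, 2 <= t i) ->
  (forall i j, i != j -> coprime (t i) (t j)) ->
  let L := \prod_(i < d) t i in
  let n := fun i : 'I_d => L %/ t i in
  m \in semigroup_gen n ->
  ~~ (L %| m) ->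
  euler_char (sqfree_divisor_complex n m) = 0%R.
Proof.
move=> _ t_ge2 cop L n _ nLm.
have [j ntjm] : exists j, ~~ (t j %| m).
  apply/existsP; apply: contraR nLm; rewrite negb_exists => /forallP dvd_m.
  apply: dvdn_prod_coprime => // [|i _]; first exact: index_enum_uniq.
  by have := dvd_m i; rewrite negbK.
apply: (@euler_char_cone _ _ j) => F.
apply: (@sqfree_divisor_complex_apex _ _ _ (t j)) => // i ij.
rewrite /n /L (bigD1 i) //= mulKn; last exact: leq_trans (t_ge2 i).
by rewrite (bigD1 j) 1?eq_sym //= dvdn_mulr.
Qed.
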